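(* Let $K$ be a field, $n>0$, $B=K[x_1,\dots,x_n]$, and let $\varphi:B\to B$ be a $K$-algebra homomorphism with $A=\varphi(B)$. Let $e=\deg(\varphi)$ and $m=2^n e^{n-1}(n+e^n)$. The following are equivalent: (i) $\varphi$ is integral, i.e. $B$ is integral over $A$; (ii) there exist monic polynomials $F_1,\dots,F_n\in A[T]$, each of degree $e^n$ and with all coefficients in $\varphi(B_{\le m})$, such that $F_i(x_i)=0$ for $i=1,\dots,n$.
   Context: $\deg(\varphi)=\max\{\deg\varphi(x_1),\dots,\deg\varphi(x_n)\}$ with $\deg$ the total degree; $B_{\le d}$ denotes the $K$-subspace of polynomials of total degree $\le d$. *)

(* Defs.v *)
From HB Require Import structures.
From mathcomp Require Import all_boot all_order all_algebra.
From mathcomp Require Export mpoly.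
Set Implicit Arguments. Unset Strict Implicit. Unset Printing Implicit Defensive.
Import GRing.Theory.
Local Open Scope ring_scope.

(* total degree of a multivariate polynomial: (msize p).-1  (0 for p = 0) *)
Definition tdeg (n : nat) (K : fieldType) (p : {mpoly K[n]}) : nat := (msize p).-1.

Definition hom_deg (n : nat) (K : fieldType)
  (phi : {mpoly K[n]} -> {mpoly K[n]}) : nat :=
  \max_(i < n) tdeg (phi 'X_i).

Definition integral_hom (n : nat) (K : fieldType)
  (phi : {mpoly K[n]} -> {mpoly K[n]}) : Prop :=
  forall b : {mpoly K[n]}, exists F : {poly {mpoly K[n]}},
    [/\ F \is monic, (forall j, exists a, F`_j = phi a) & F.[b] = 0].

(* Main.v *)
Require Import Defs.
From HB Require Import structures.
From mathcomp Require Import all_boot all_order all_algebra.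
From mathcomp Require Import mpoly.
From mathcomp Require Import ring zify.
From Stdlib Require Import Classical IndefiniteDescription.
Import Order.TTheory GRing.Theory.
Set Implicit Arguments. Unset Strict Implicit. Unset Printing Implicit Defensive.
Local Open Scope ring_scope.

(**
If [phi] is integral it is injective, so that A is a polynomial ring and
relations of [x_i] over A can be identified with elements of K[y][T].

Counting monomials, the products [x_i^a * phi(y^b)] with [a <= e^n] and
[|b| <= m] outnumber the monomials of degree at most [e^n + e * m], so [x_i]
satisfies a nonzero relation P of T-degree at most [e^n] whose coefficients have
degree at most [m].  Let Q be a relation of minimal T-degree and q its leading
coefficient; Q divides the integral equation of [x_i] up to a scalar.  K[y] is
completely integrally closed (compare leading monomials), and the powers of
[Q / q], a characteristic polynomial, have a common denominator; hence q divides
Q.  The monic relation [Q / q] divides P, which bounds the degrees of its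
coefficients; multiplying by a power of T gives it the T-degree [e^n].
*)

(** * Minimal elements and Dickson's lemma *)

Lemma nat_min_pred (P : nat -> Prop) :
  (exists i, P i) -> exists2 i, P i & forall j, P j -> (i <= j)%N.
Proof.
move=> [i Pi]; elim/ltn_ind: i Pi => i IH Pi.
have [[j [ltji Pj]]|none] := classic (exists j, (j < i)%N /\ P j).
  exact: IH ltji Pj.
exists i => // j Pj; rewrite leqNgt; apply/negP => ltji.
by apply: none; exists j.
Qed.

Definition unbounded (S : nat -> Prop) := forall N, exists2 i, (N <= i)%N & S i.

(* The indices after which [u] never takes a smaller value form an unbounded
   set, on which [u] is nondecreasing. *)
Lemma unbounded_nondecreasing (S : nat -> Prop) (u : nat -> nat) :
  unbounded S -> exists S', [/\ unbounded S', forall i, S' i -> S i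
    & forall i j, S' i -> S' j -> (i < j)%N -> (u i <= u j)%N].
Proof.
move=> infS; exists (fun i => S i /\ forall j, S j -> (i < j)%N -> (u i <= u j)%N).
split=> [N|i []|i j [_ mini] [Sj _] ltij] //; last exact: mini.
pose P v := exists i, [/\ (N <= i)%N, S i & u i = v].
have [v [i [leNi Si <-]] minv] : exists2 v, P v & forall w, P w -> (v <= w)%N.
  by apply: nat_min_pred; have [i Ni Si] := infS N; exists (u i), i.
exists i => //; split=> // j Sj ltij; apply: minv.
by exists j; split=> //; exact: leq_trans leNi (ltnW ltij).
Qed.

(** Thinning an unbounded index set once per coordinate makes all coordinates nondecreasing along
    what remains. *)
Lemma dickson n (u : nat -> 'X_{1..n}) :
  exists i j, (i < j)%N /\ (u i <= u j)%MM.
Proof.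
suff [S [infS Su]] : exists S, unbounded S /\ forall i j, S i -> S j -> (i < j)%N ->
    forall k, k \in enum 'I_n -> (u i k <= u j k)%N.
  have [i _ Si] := infS 0%N; have [j ltij Sj] := infS i.+1.
  by exists i, j; split=> //; apply/mnm_lepP => k; apply: Su; rewrite ?mem_enum.
elim: (enum 'I_n) => [|k r [S [infS Su]]].
  by exists (fun=> True); split=> // N; exists N.
have [S' [infS' subS Sk]] := unbounded_nondecreasing (fun i => u i k) infS.
exists S'; split=> // i j Si Sj ltij l; rewrite inE => /orP[/eqP->|]; first exact: Sk.
by apply: Su => //; apply: subS.
Qed.

(** * Complete integral closedness of polynomial rings *)

Lemma sub_mul_power_dvd (R : comNzRingType) (a b c t : R) :
    (forall k, exists d, c * a ^+ k = d * b ^+ k) ->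
  forall k, exists d, c * (a - t * b) ^+ k = d * b ^+ k.
Proof.
move=> dvd_a k.
(* The extra factor [a ^+ j] lets the induction on [k] peel off one factor [a - t * b] at a time. *)
suff: forall k j, exists d, c * a ^+ j * (a - t * b) ^+ k = d * b ^+ (j + k).
  by move=> /(_ k 0%N); rewrite mulr1 add0n.
elim=> [|{}k IH] j; first by rewrite mulr1 addn0.
have [d dE] := IH j.+1; have [d' d'E] := IH j.
exists (d - t * d').
have -> : c * a ^+ j * (a - t * b) ^+ k.+1 =
    c * a ^+ j.+1 * (a - t * b) ^+ k - t * b * (c * a ^+ j * (a - t * b) ^+ k).
  by rewrite !exprS; ring.
by rewrite dE d'E addSn addnS exprS; ring.
Qed.

(* The last hypothesis says that [c (a/b)^k] lies in [R] for all [k]. *)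
Definition completely_integrally_closed (R : idomainType) :=
  forall a b c : R, b != 0 -> c != 0 ->
    (forall k, exists d, c * a ^+ k = d * b ^+ k) -> exists d, a = d * b.

(** One division step, [t] being the quotient of the leading terms. A zero remainder is excluded
    because [mlead 0] is the zero exponent, which need not lie below [mlead a]. *)
Lemma lead_reduce (K : fieldType) n (a b : {mpoly K[n]}) :
    b != 0 -> a != 0 -> (mlead b <= mlead a)%MM ->
  exists t, a - t * b != 0 -> (mlead (a - t * b) < mlead a)%O.
Proof.
move=> b0 a0 leba; pose t := (mleadc a / mleadc b) *: 'X_[mlead a - mlead b].
exists t => a_tb.
have b0' : mleadc b != 0 by rewrite mleadc_eq0.
have ct0 : mleadc a / mleadc b != 0.
  by rewrite mulf_neq0 ?invr_eq0 ?mleadc_eq0.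
have lead_t : mlead t = (mlead a - mlead b)%MM by rewrite mleadZ // mleadXm.
have coef_t : mleadc t = mleadc a / mleadc b.
  by rewrite lead_t mcoeffZ mcoeffX eqxx mulr1.
have t0 : t != 0 by rewrite -mleadc_eq0 coef_t.
have lead_tb : mlead (t * b) = mlead a by rewrite mleadM // lead_t submK.
have coef_tb : (t * b)@_(mlead a) = mleadc a.
  by rewrite -[X in _@_X](submK leba) -lead_t mleadcM coef_t divfK.
rewrite lt_neqAle; apply/andP; split; last first.
  by apply: le_trans (mleadB_le _ _) _; rewrite lead_tb joinxx.
apply: contra_neq a_tb => lead_eq.
by apply/eqP; rewrite -mleadc_eq0 lead_eq mcoeffB coef_tb subrr.
Qed.

Lemma mpoly_completely_integrally_closed (K : fieldType) n :
  completely_integrally_closed {mpoly K[n]}.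
Proof.
move=> a b c b0 c0; elim/mleadrect: a => a IH dvd_a.
have [->|a0] := eqVneq a 0; first by exists 0; rewrite mul0r.
have leba : (mlead b <= mlead a)%MM.
  apply/mnm_lepP => i; rewrite leqNgt; apply/negP => lti.
  (* With k = [(mlead c i).+1], comparing the exponents of variable i in c a^k = d b^k would force k
     <= [mlead c i]. *)
  have [d dE] := dvd_a (mlead c i).+1.
  have d0 : d != 0.
    apply: contra_neq (mulf_neq0 c0 (expf_neq0 (mlead c i).+1 a0)) => d0.
    by rewrite dE d0 mul0r.
  have := congr1 (@mlead _ _) dE.
  rewrite (mleadM c0 (expf_neq0 _ a0)) (mleadM d0 (expf_neq0 _ b0)).
  rewrite (mleadX _ a0) (mleadX _ b0) => /mnmP/(_ i).
  rewrite !mnmDE !mulmnE => E.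
  have := leq_mul lti (leqnn (mlead c i).+1).
  by rewrite mulSn; lia.
have [t lt_t] := lead_reduce b0 a0 leba.
have [/eqP|a_tb] := eqVneq (a - t * b) 0.
  by rewrite subr_eq0 => /eqP->; exists t.
have [||d dE] := IH (a - t * b); [exact: lt_t|exact: sub_mul_power_dvd|].
by exists (d + t); rewrite mulrDl -dE subrK.
Qed.

(** * Integral endomorphisms are injective *)

(* If [phi] is not injective, the kernels of the powers of [phi], all of them
   prime, form a strictly increasing chain: if [b] lies in the kernel of
   [phi^(k+1)] but not in that of [phi^k], then so does the constant term of an
   integral equation of [b] of minimal degree modulo the latter, and that term is
   a value of [phi].  Choosing elements of minimal leading monomial in the
   successive differences contradicts Dickson's lemma. *)
Lemma integral_endo_inj (K : fieldType) n
    (phi : {lrmorphism {mpoly K[n]} -> {mpoly K[n]}}) :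
  integral_hom phi -> injective phi.
Proof.
move=> phi_int; apply: raddf_inj => h phih0; apply: NNPP => /eqP h0.
pose f k := iter k phi.
have f0 k : f k 0 = 0 by elim: k => //= k ->; rewrite raddf0.
have f1 k : f k 1 = 1 by elim: k => //= k ->; rewrite rmorph1.
have fD k a b : f k (a + b) = f k a + f k b.
  by elim: k => //= k ->; rewrite raddfD.
have fM k a b : f k (a * b) = f k a * f k b.
  by elim: k => //= k ->; rewrite rmorphM.
have fB k a b : f k (a - b) = f k a - f k b.
  by elim: k => //= k ->; rewrite raddfB.
pose J k b := f k b != 0 /\ f k.+1 b = 0.
have step k b : J k b -> exists b', J k.+1 b'.
  move=> [fkb fk1b]; have [F [Fmon Fphi Fb]] := phi_int b.
  have {Fb} : f k F.[b] = 0 by rewrite Fb f0.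
  (* Either [f k] does not kill the constant term [c = phi c'], and [c'] is the witness, or [c] is
     dropped and [f k b], nonzero in a domain, is cancelled. *)
  elim/poly_ind: F Fmon Fphi => [|F c IH] Fmon Fphi.
    by rewrite monicE lead_coef0 eq_sym oner_eq0 in Fmon.
  have [F0|F0] := eqVneq F 0.
    move: Fmon; rewrite F0 mul0r add0r monicE lead_coefC hornerC => /eqP->.
    by rewrite f1 => /eqP; rewrite oner_eq0.
  rewrite hornerMXaddC => fkF0.
  have fkF : f k F.[b] * f k b + f k c = 0 by rewrite -fM -fD.
  have [c' c'E] : exists c', c = phi c'.
    by have [c'] := Fphi 0%N; rewrite coefD coefMX coefC add0r; exists c'.
  have fk1c : f k.+1 c = 0.
    have : f k.+1 (F.[b] * b + c) = 0 by rewrite [LHS]/= -/(f k _) fkF0 raddf0.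
    by rewrite fD fM fk1b mulr0 add0r.
  have [fkc|fkc] := eqVneq (f k c) 0; last first.
    have fS j : f j.+1 c' = f j c by rewrite /f iterSr c'E.
    by exists c'; split; rewrite fS.
  apply: IH.
  - move: Fmon; rewrite !monicE lead_coefDl ?lead_coefMX // size_mulX // ltnS.
    by rewrite (leq_trans (size_polyC_leq1 c)) ?size_poly_gt0.
  - move=> j; have [a] := Fphi j.+1.
    by rewrite coefD coefMX coefC addr0; exists a.
  by apply/eqP; move/eqP: fkF; rewrite fkc addr0 mulf_eq0 (negPf fkb) orbF.
have Jne k : exists b, J k b.
  by elim: k => [|k [b /step//]]; exists h.
have minJ k : exists b, J k b /\ forall b', J k b' -> (mlead b <= mlead b')%O.
  have [b] := Jne k; elim/mleadrect: b => b IH Jb.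
  have [[b' [ltb Jb']]|none] := classic (exists b', (mlead b' < mlead b)%O /\ J k b').
    exact: IH ltb Jb'.
  exists b; split=> // b' Jb'; rewrite leNgt; apply/negP => ltb.
  by apply: none; exists b'.
have [b bP] := functional_choice _ minJ.
have [i [j [ltij]]] := dickson (fun k => mlead (b k)).
have [[fib fi1b] _] := bP i; have [[fjb fj1b] minj] := bP j.
have fjbi : f j (b i) = 0.
  by rewrite -(subnK ltij) /f iterD -/(f i.+1 _) fi1b; apply: f0.
have bi0 : b i != 0 by apply: contra_neq fib => ->.
have bj0 : b j != 0 by apply: contra_neq fjb => ->.
move=> lead_ij; have [t lt_t] := lead_reduce bi0 bj0 lead_ij.
(* As i < j, [f j] kills [b i]: the reduction stays in [J j], against the minimality of [b j]. *)
have : J j (b j - t * b i).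
  by split; rewrite fB fM ?fjbi ?mulr0 ?subr0 //= -/(f j _) fjbi raddf0 mulr0 subr0.
have [bt0|bt0 /minj] := eqVneq (b j - t * b i) 0; first by rewrite bt0 /J f0 eqxx => -[].
by rewrite leNgt lt_t.
Qed.

(** * Polynomials dividing a monic one up to a constant *)

(** The hypothesis passes to leading coefficients, so [q] divides that of [Q]; removing the leading
    term then preserves the hypothesis. *)
Lemma const_dvd_poly (R : idomainType) (Q c : {poly R}) (q : R) :
    completely_integrally_closed R -> q != 0 -> c != 0 ->
    (forall k, exists d, c * Q ^+ k = d * q%:P ^+ k) ->
  exists mu, Q = mu * q%:P.
Proof.
move=> cicR q0 c0; have [n] := ubnP (size Q).
elim: n Q => // n IH Q leQn dvdQ.
have [->|Q0] := eqVneq Q 0; first by exists 0; rewrite mul0r.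
have [t tE] : exists t, lead_coef Q = t * q.
  apply: (cicR _ _ (lead_coef c)); rewrite ?lead_coef_eq0 // => k.
  have [d /(congr1 lead_coef)] := dvdQ k.
  rewrite !lead_coefM !lead_coef_exp lead_coefC => dE.
  by exists (lead_coef d).
pose m := (size Q).-1.
have [||mu muE] := IH (Q - t *: 'X^m * q%:P).
- rewrite -ltnS (leq_trans _ leQn) // ltnS.
  have szQ : (0 < size Q)%N by rewrite size_poly_gt0.
  rewrite -(prednK szQ) -/m ltnS; apply/leq_sizeP => j lej.
  rewrite coefB mulrC coefCM coefZ coefXn.
  move: lej; rewrite leq_eqVlt => /orP[/eqP<-|ltj].
    by rewrite eqxx mulr1 mulrC -tE lead_coefE subrr.
  by rewrite gtn_eqF // !mulr0 subr0 nth_default // -(prednK szQ).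
- exact: sub_mul_power_dvd.
by exists (mu + t *: 'X^m); rewrite mulrDl -muE subrK.
Qed.

Lemma horner_mxE (F : comNzRingType) d (C : 'M[F]_d.+1) (p : {poly F}) :
  horner_mx C p = \sum_(i < size p) p`_i *: C ^+ i.
Proof.
rewrite -[in LHS](coefK p) poly_def raddf_sum; apply: eq_bigr => i _ /=.
by rewrite linearZ /= rmorphXn /= horner_mx_X.
Qed.

(* The powers of [C] lie in a finitely generated module over the image of [R],
   hence so do those of ['X - C]; take determinants. *)
Lemma char_poly_almost_integral (R F : comNzRingType) (f : {rmorphism R -> F})
    d (C : 'M[F]_d.+1) (G : {poly R}) (q : R) (C0 : 'M[R]_d.+1) :
    G \is monic -> horner_mx C (map_poly f G) = 0 -> f q *: C = map_mx f C0 ->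
  forall k, exists D : {poly R},
    (f q ^+ (size G).-1) ^+ d.+1 *: char_poly C ^+ k = map_poly f D.
Proof.
move=> Gmon GC qC k; set N := (size G).-1.
(* [L] singles out the matrices with entries in the image of R[T]; [s] will be a common denominator
   of all powers of [C]. *)
pose L (A : 'M[{poly F}]_d.+1) :=
  exists A0 : 'M[{poly R}]_d.+1, A = map_mx (map_poly f) A0.
pose C' := map_mx polyC C.
pose s := (f q ^+ N)%:P.
have LD A B : L A -> L B -> L (A + B).
  by move=> [A0 ->] [B0 ->]; exists (A0 + B0); rewrite map_mxD.
have LZ (p : {poly R}) A : L A -> L (map_poly f p *: A).
  by move=> [A0 ->]; exists (p *: A0); rewrite map_mxZ.
have L0 : L 0 by exists 0; rewrite map_mx0.
have LM A B : L A -> L B -> L (A * B).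
  by move=> [A0 ->] [B0 ->]; exists (A0 *m B0); rewrite map_mxM.
have LX j A : L A -> L (A ^+ j).
  by move=> LA; elim: j => [|j]; [exists 1; rewrite map_mx1|rewrite exprS; apply: LM].
have LqC : L ((f q)%:P *: C').
  exists (map_mx polyC C0); rewrite -map_mxZ qC -!map_mx_comp.
  by apply: eq_map_mx => x /=; rewrite map_polyC.
have LsC j : L (s *: C' ^+ j).
  (* Below [N], the power of [f q] in [s] clears the denominators; from [N] on, the equation [G]
     expresses the power of [C] through lower ones. *)
  elim/ltn_ind: j => j IH; have [leNj|ltjN] := leqP N j; last first.
    have -> : s *: C' ^+ j = map_poly f (q ^+ (N - j))%:P *: ((f q)%:P *: C') ^+ j.
      rewrite exprZn scalerA map_polyC /= rmorphXn /= -[in X in _ *: _ = X *: _]polyC_exp.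
      by rewrite -polyCM -exprD subnK // ltnW.
    by apply: LZ; apply: LX.
  have CN : C ^+ N = - \sum_(i < N) f G`_i *: C ^+ i.
    move: GC; rewrite horner_mxE size_map_poly_id0; last first.
      by rewrite (monicP Gmon) rmorph1 oner_eq0.
    have szG : size G = N.+1 by rewrite prednK // size_poly_gt0 monic_neq0.
    rewrite szG big_ord_recr /= coef_map.
    have -> : G`_N = 1 by rewrite -(monicP Gmon).
    rewrite /= rmorph1 scale1r addrC => /eqP; rewrite addr_eq0 => /eqP->.
    by congr (- _); apply: eq_bigr => i _; rewrite coef_map.
  have -> : s *: C' ^+ j =
      \sum_(i < N) map_poly f (- G`_i)%:P *: (s *: C' ^+ (j - N + i)).
    rewrite -[in LHS](subnK leNj) exprD -[C' ^+ N]rmorphXn /= CN.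
    rewrite raddfN raddf_sum /= mulrN mulr_sumr -sumrN scaler_sumr.
    apply: eq_bigr => i _.
    rewrite map_mxZ rmorphXn /= -scalerAr -exprD map_polyC /= rmorphN polyCN scaleNr.
    by rewrite scalerN; congr (- _); rewrite !scalerA mulrC.
  elim/big_ind: _ => // i _; apply: LZ; apply: IH.
  by have := ltn_ord i; lia.
have LsXC j : L (s *: (C' ^+ j * char_poly_mx C ^+ k)).
  elim: k j => [|k' IH] j; first by rewrite mulr1.
  have -> : s *: (C' ^+ j * char_poly_mx C ^+ k'.+1) =
      map_poly f 'X *: (s *: (C' ^+ j * char_poly_mx C ^+ k')) +
      map_poly f (-1)%:P *: (s *: (C' ^+ j.+1 * char_poly_mx C ^+ k')).
    rewrite map_polyX map_polyC /= rmorphN1 exprS {1}/char_poly_mx.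
    rewrite mulrA mulrBr mulrBl -exprSr scalerBr; congr (_ + _).
      by rewrite -scalemx1 -scalerAr mulr1 -scalerAl !scalerA mulrC.
    by rewrite polyCN scaleNr scale1r.
  by apply: LD; apply: LZ.
have [A0 /(congr1 determinant)] := LsXC 0%N.
rewrite expr0 mul1r detZ det_map_mx => detE; exists (\det A0).
rewrite -detE /s -polyC_exp -mul_polyC; congr (_ * _).
by elim: (k) => [|k' IH]; rewrite ?det1 // !exprS det_mulmx IH.
Qed.

(** Over the fraction field, Q/q is the characteristic polynomial of its companion matrix. By
    Cayley-Hamilton [G] kills this matrix, and [q] times it has entries in [R], so the powers of Q/q
    share a denominator. *)
Lemma monic_minimal_factor (R : idomainType) (Q S G : {poly R}) (s : R) :
    completely_integrally_closed R -> G \is monic -> s != 0 -> s *: G = Q * S ->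
  exists mu, Q = mu * (lead_coef Q)%:P.
Proof.
move=> cicR Gmon s0 sG; set q := lead_coef Q.
have QS0 : Q * S != 0 by rewrite -sG scale_poly_eq0 negb_or s0 monic_neq0.
have Q0 : Q != 0 by apply: contra_neq QS0 => ->; rewrite mul0r.
have q0 : q != 0 by rewrite lead_coef_eq0.
case szQ : (size Q) => [|[|d]].
- by move/eqP: szQ; rewrite size_poly_eq0 (negPf Q0).
- exists 1; rewrite mul1r; apply/polyP => -[|i]; rewrite coefC /=.
    by rewrite /q lead_coefE szQ.
  by rewrite nth_default // szQ.
pose f : {rmorphism R -> {fraction R}} := @FracField.tofrac R.
have finj : injective f by move=> x y /eqP; rewrite tofrac_eq => /eqP.
have fq0 : f q != 0 by rewrite tofrac_eq0.
pose p := (f q)^-1 *: map_poly f Q.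
have szp : size p = d.+2 by rewrite size_scale ?invr_eq0 // size_map_inj_poly ?rmorph0.
have pmon : p \is monic.
  by rewrite monicE lead_coefZ lead_coef_map_inj ?rmorph0 // mulVf.
have [C [charC [C0 qC]]] : exists C : 'M[{fraction R}]_d.+1,
    char_poly C = p /\ exists C0, f q *: C = map_mx f C0.
  have -> : d.+1 = (size p).-1 by rewrite szp.
  exists (companionmx p); split; first exact: companionmxK.
  exists (\matrix_(i, j) if i == (size p).-2 :> nat then - Q`_j
                         else q * (i.+1 == j :> nat)%:R).
  apply/matrixP => i j; rewrite !mxE; case: ifP => _.
    by rewrite coefZ coef_map mulrN mulVKf // rmorphN.
  by rewrite rmorphM rmorph_nat.
have GC : horner_mx C (map_poly f G) = 0.
  have : f s *: horner_mx C (map_poly f G) = 0.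
    rewrite -linearZ /= -map_polyZ sG rmorphM rmorphM /=.
    have -> : map_poly f Q = f q *: p by rewrite scalerA mulfV // scale1r.
    by rewrite -charC linearZ /= Cayley_Hamilton scaler0 mul0r.
  by move/eqP; rewrite scaler_eq0 tofrac_eq0 (negPf s0) => /eqP.
apply: (@const_dvd_poly _ _ ((q ^+ (size G).-1) ^+ d.+1)%:P) => //.
  by rewrite polyC_eq0 !expf_neq0.
move=> k; have [D] := char_poly_almost_integral Gmon GC qC k.
move=> DE; exists D; apply: (map_inj_poly finj (rmorph0 f)).
rewrite !rmorphM /= -DE charC /p exprZn map_polyC /= !rmorphXn /= map_polyC /=.
rewrite -!mul_polyC -!polyC_exp exprVn. 
by rewrite -mulrA; congr (_ * _); rewrite mulrAC -polyCM mulVf ?expf_neq0 // mul1r.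
Qed.

(** * Counting monomials *)

Lemma card_bmultinom n d : #|{: 'X_{1..n < d.+1}}| = 'C(n + d, n).
Proof.
rewrite -card_partial_ord_partitions.
pose f (m : 'X_{1..n < d.+1}) := [tuple inord ((m : 'X_{1..n}) i) : 'I_d.+1 | i < n].
have f_val m i : tnth (f m) i = (m : 'X_{1..n}) i :> nat.
  rewrite tnth_mktuple inordK // (leq_ltn_trans _ (bmdeg m)) //.
  by rewrite mdegE (bigD1 i) //= leq_addr.
have f_inj : injective f.
  by move=> m m' fE; apply/val_inj/mnmP => i; rewrite -!f_val fE.
rewrite -cardsT -(card_imset _ f_inj); apply: eq_card => t.
have sumE : (\sum_(i <- t) i = \sum_i (tnth t i : nat))%N by rewrite big_tuple.
rewrite inE sumE; apply/imsetP/idP => [[m _ ->]|let_d].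
  rewrite (eq_bigr (fun i => (m : 'X_{1..n}) i)) => [|i _]; last exact: f_val.
  by rewrite -mdegE -ltnS bmdeg.
pose m := [multinom (tnth t i : nat) | i < n].
have ltm : (mdeg m < d.+1)%N.
  by rewrite mdegE ltnS (eq_bigr (fun i => tnth t i : nat)) // => i _; rewrite mnmE.
exists (BMultinom ltm) => //; apply: eq_from_tnth => i; apply/val_inj.
by rewrite [RHS]f_val /= mnmE.
Qed.

(** In the binomial expansion, every lower power of M is at most M^n, and the binomial coefficients
    other than the top one sum to 2^(n+1) - 1. *)
Lemma expnS_le M n : (0 < M)%N -> (M.+1 ^ n.+1 <= M ^ n.+1 + (2 ^ n.+1 - 1) * M ^ n)%N.
Proof.
move=> M0; elim: n => [|n IH]; first by rewrite !expn1 expn0; lia.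
rewrite expnS (leq_trans (leq_mul (leqnn M.+1) IH)) //.
have tn : (0 < 2 ^ n)%N by rewrite expn_gt0.
rewrite !expnS; move: (M ^ n)%N (2 ^ n)%N tn => x y y0.
have -> : (2 * (2 * y) - 1 = 2 * (2 * y - 1) + 1)%N by lia.
move: (2 * y - 1)%N => z; rewrite -(prednK M0); move: M.-1 => M'.
by nia.
Qed.

Lemma bin_dimension_lt e n : (0 < e)%N -> (0 < n)%N ->
  let m := (2 ^ n * e ^ n.-1 * (n + e ^ n))%N in
  ('C(n + (e ^ n + e * m), n) < (e ^ n).+1 * 'C(n + m, n))%N.
Proof.
move=> e0 n0; set E := (e ^ n)%N => /=; set m := (_ * (n + E))%N.
pose w := (e ^ n.-1)%N; pose M := (2 ^ n * (n + E))%N.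
have mE : m = (M * w)%N by rewrite /m /M mulnAC.
have EE : E = (e * w)%N by rewrite /E /w -expnS prednK.
have E0 : (0 < E)%N by rewrite expn_gt0 e0.
have M0 : (0 < M)%N by rewrite muln_gt0 expn_gt0 addn_gt0 n0.
(* The choice of [m] enters here: by [expnS_le] the claim comes down to E (2^n - 1) < M, where M =
   2^n (n + E). *)
have EM : (E * M.+1 ^ n < E.+1 * M ^ n)%N.
  have := expnS_le n.-1 M0; rewrite prednK // => le1.
  rewrite (leq_ltn_trans (leq_mul (leqnn E) le1)) // mulSn mulnDr addnC ltn_add2r.
  have -> : (M ^ n = M * M ^ n.-1)%N by rewrite -expnS prednK.
  rewrite mulnA ltn_pmul2r ?expn_gt0 ?M0 //.
  have : (0 < 2 ^ n * n)%N by rewrite muln_gt0 expn_gt0 n0.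
  by rewrite /M mulnBr muln1 mulnDr [(E * _)%N]mulnC; lia.
rewrite -(ltn_pmul2r (fact_gt0 n)) -mulnA !bin_ffact.
have Y0 : (0 < (n + m) ^_ n)%N by rewrite ffact_gt0 leq_addr.
rewrite -(@ltn_pmul2l (M ^ n)) ?expn_gt0 ?M0 //.
apply: (@leq_ltn_trans (E * M.+1 ^ n * (n + m) ^_ n)%N); last first.
  by rewrite mulnA [(M ^ n * _)%N]mulnC ltn_pmul2r.
rewrite !ffact_prod -expnMn.
have prod_cst c : (c ^ n = \prod_(i < n) c)%N by rewrite prod_nat_const card_ord.
(* The products are compared factor by factor: with y = n - i and m = M w, the inequality M (y + e
   (w + m)) <= e (M + 1) (y + m) reduces to M y <= e (M + 1) y. *)
rewrite (prod_cst M) (prod_cst (e * M.+1)%N) -!big_split /=; apply: leq_prod => i _.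
have lti := ltn_ord i.
have -> : (n + (E + e * m) - i = (n - i) + e * (w + m))%N by rewrite EE; lia.
have -> : (n + m - i = (n - i) + m)%N by lia.
by move: (n - i)%N => y; nia.
Qed.

(** * Small relations by linear algebra *)

(** The coefficient matrix has more rows than columns, hence a nonzero left kernel. *)
Lemma linear_dependence (K : fieldType) n d (I : finType) (v : I -> {mpoly K[n]}) :
    (forall i, (msize (v i) <= d.+1)%N) -> ('C(n + d, n) < #|I|)%N ->
  exists c : I -> K, (exists i, c i != 0) /\ \sum_i c i *: v i = 0.
Proof.
move=> size_v ltI; pose J : finType := 'X_{1..n < d.+1}.
pose M : 'M[K]_(#|I|, #|J|) :=
  \matrix_(i, j) (v (enum_val i))@_(enum_val j : J).
have : kermx M != 0.
  rewrite -mxrank_eq0 mxrank_ker -lt0n subn_gt0.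
  by rewrite (leq_ltn_trans (rank_leq_col M)) // card_bmultinom.
case/rowV0Pn => u /sub_kermxP uM u0.
exists (fun i => u 0 (enum_rank i)); split.
  have [j uj] := rV0Pn _ u0.
  by exists (enum_val j); rewrite enum_valK.
apply/mpolyP => m; rewrite mcoeff0 raddf_sum /=.
have [ltm|lem] := ltnP (mdeg m) d.+1; last first.
  apply: big1 => i _; rewrite mcoeffZ memN_msupp_eq0 ?mulr0 //.
  exact: msize_mdeg_ge (leq_trans (size_v i) lem).
have := congr1 (fun A : 'rV_ _ => A 0 (enum_rank (BMultinom ltm : J))) uM.
rewrite !mxE => sum0; rewrite -[RHS]sum0.
rewrite (reindex (fun i : 'I_#|I| => enum_val i)) /=; last first.
  by exists enum_rank => i _; rewrite ?enum_valK ?enum_rankK.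
by apply: eq_bigr => i _; rewrite mcoeffZ mxE enum_valK enum_rankK.
Qed.

Lemma msizeM_bound (K : fieldType) n (p q : {mpoly K[n]}) a b :
  (msize p <= a.+1)%N -> (msize q <= b.+1)%N -> (msize (p * q)%R <= (a + b).+1)%N.
Proof.
have [->|p0] := eqVneq p 0; first by rewrite mul0r msize0.
have [->|q0] := eqVneq q 0; first by rewrite mulr0 msize0.
by rewrite msizeM //; move: (msize p) (msize q) => x y; lia.
Qed.

Lemma msizeX_bound (K : fieldType) n (p : {mpoly K[n]}) a k :
  (msize p <= a.+1)%N -> (msize (p ^+ k)%R <= (a * k).+1)%N.
Proof.
move=> lep; elim: k => [|k IH]; first by rewrite msize1.
by rewrite exprS mulnS msizeM_bound.
Qed.

Lemma msize_hom_monomial (K : fieldType) n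
    (phi : {lrmorphism {mpoly K[n]} -> {mpoly K[n]}}) (m : 'X_{1..n}) :
  (msize (phi 'X_[m]) <= (hom_deg phi * mdeg m).+1)%N.
Proof.
rewrite mpolyXE_id rmorph_prod mdegE big_distrr /=.
elim/big_ind2: _ => [|a p b q|i _]; [by rewrite msize1|exact: msizeM_bound|].
rewrite rmorphXn msizeX_bound // (leq_trans (leqSpred _)) // ltnS.
exact: (@leq_bigmax _ (fun i => tdeg (phi 'X_i)) i).
Qed.

Lemma small_relation (K : fieldType) n
    (phi : {lrmorphism {mpoly K[n]} -> {mpoly K[n]}}) (x : {mpoly K[n]}) :
    let e := hom_deg phi in let m := (2 ^ n * e ^ n.-1 * (n + e ^ n))%N in
    (0 < n)%N -> (0 < e)%N -> (msize x <= 2)%N ->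
  exists P : {poly {mpoly K[n]}},
    [/\ P != 0, (size P <= (e ^ n).+1)%N, forall j, (msize P`_j <= m.+1)%N
      & (map_poly phi P).[x] = 0].
Proof.
move=> e m n0 e0 size_x.
pose I := ('I_(e ^ n).+1 * 'X_{1..n < m.+1})%type.
pose v (i : I) := x ^+ i.1 * phi 'X_[(i.2 : 'X_{1..n})].
have size_v i : (msize (v i) <= (e ^ n + e * m).+1)%N.
  have : (msize (v i) <= (1 * i.1 + e * mdeg (i.2 : 'X_{1..n})).+1)%N.
    by apply: msizeM_bound; [exact: msizeX_bound|exact: msize_hom_monomial].
  move/leq_trans; apply; rewrite ltnS mul1n; apply: leq_add.
    by rewrite -ltnS; exact: ltn_ord.
  by rewrite leq_mul2l -ltnS bmdeg orbT.
have [|c [[[a al] cne] sum0]] := linear_dependence size_v.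
  by rewrite card_prod card_ord card_bmultinom; exact: bin_dimension_lt.
(* The dependence is grouped by powers of [x]. *)
pose coef j : {mpoly K[n]} := \sum_(b : 'X_{1..n < m.+1}) c (inord j, b) *: 'X_[b].
exists (\poly_(j < (e ^ n).+1) coef j); split.
- apply: contra_neq cne => /polyP/(_ a).
  rewrite coef_poly ltn_ord coef0 => /(congr1 (mcoeff al)).
  rewrite mcoeff0 raddf_sum (bigD1 al) //= mcoeffZ mcoeffX eqxx mulr1.
  rewrite big1 ?addr0 ?inord_val // => b neb.
  by rewrite mcoeffZ mcoeffX -bmeqP (negPf neb) mulr0.
- exact: size_poly.
- move=> j; rewrite coef_poly; case: ifP => _; last by rewrite msize0.
  rewrite (leq_trans (msize_sum _ _ _)) //; apply/bigmax_leqP => b _.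
  by rewrite (leq_trans (msizeZ_le _ _)) // msizeX bmdeg.
rewrite (@horner_coef_wide _ (e ^ n).+1); last first.
  by rewrite (leq_trans (size_poly _ _)) // size_poly.
transitivity (\sum_j \sum_b c (j, b) *: v (j, b)); last first.
  by rewrite pair_bigA -[RHS]sum0; apply: eq_bigr => -[].
apply: eq_bigr => j _; rewrite coef_map /= coef_poly ltn_ord raddf_sum mulr_suml.
by apply: eq_bigr => b _ /=; rewrite linearZ /= inord_val -scalerAl mulrC.
Qed.

(** * Degrees of the coefficients of a factor *)

Lemma top_msize_coef (K : fieldType) n (p : {poly {mpoly K[n]}}) : p != 0 ->
  exists i, [/\ p`_i != 0, forall j, (msize p`_j <= msize p`_i)%N
    & forall j, (i < j)%N -> (msize p`_j < msize p`_i)%N].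
Proof.
move=> p0; pose M := \max_(i < size p) msize p`_i.
have leM j : (msize p`_j <= M)%N.
  have [ltj|lej] := ltnP j (size p); last by rewrite nth_default // msize0.
  exact: (@leq_bigmax _ (fun i : 'I_(size p) => msize p`_i) (Ordinal ltj)).
have M0 : (0 < M)%N.
  rewrite (leq_trans _ (leM (size p).-1)) // lt0n msize_poly_eq0.
  by rewrite -lead_coefE lead_coef_eq0.
have szp : (0 < size p)%N by rewrite size_poly_gt0.
pose top i := (i < size p)%N && (msize p`_i == M).
have ex : exists i, top i.
  have [|i Mi] := @bigop.eq_bigmax _ (fun i : 'I_(size p) => msize p`_i).
    by rewrite card_ord.
  by exists i; rewrite /top ltn_ord /M Mi eqxx.
have ub i : top i -> (i <= size p)%N by case/andP => /ltnW.
case: (ex_maxnP ex ub) => i /andP[lti /eqP iM] maxi.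
exists i; rewrite iM; split=> // [|j ltij].
  by rewrite -msize_poly_eq0 iM -lt0n.
rewrite ltn_neqAle leM andbT; apply/negP => jM.
have [ltj|lej] := ltnP j (size p); last first.
  by rewrite nth_default // msize0 eq_sym -leqn0 leqNgt M0 in jM.
by have := maxi j; rewrite /top ltj jM leqNgt ltij => /(_ isT).
Qed.

(* The coefficient at the sum of the last indices where [mu] and [S] have
   coefficients of maximal degree is not hit by cancellation. *)
Lemma msize_coef_factor (K : fieldType) n (mu S : {poly {mpoly K[n]}}) d :
    mu * S != 0 -> (forall j, (msize (mu * S)%R`_j <= d)%N) ->
  forall j, (msize mu`_j <= d)%N.
Proof.
rewrite mulf_eq0 => /norP[mu0 S0] leP j.
have [a [a0 lea lta]] := top_msize_coef mu0.
have [b [b0 leb ltb]] := top_msize_coef S0.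
apply: leq_trans (lea j) _; apply: leq_trans (leP (a + b)%N).
rewrite coefM (bigD1 (Ordinal (leq_addr b a : (a < (a + b).+1)%N))) //= addKn.
set r := \sum_(i < _ | _) _.
have A0 : (0 < msize mu`_a)%N by rewrite lt0n msize_poly_eq0.
have B0 : (0 < msize S`_b)%N by rewrite lt0n msize_poly_eq0.
(* In any other term either i > a, where [mu] has smaller coefficients, or a + b - i > b, where [S]
   has. *)
have ler : (msize r <= (msize mu`_a + msize S`_b).-2)%N.
  rewrite (leq_trans (msize_sum _ _ _)) //; apply/bigmax_leqP => i nei.
  have [->|p0] := eqVneq mu`_i 0; first by rewrite mul0r msize0.
  have [->|q0] := eqVneq S`_(a + b - i) 0; first by rewrite mulr0 msize0.
  rewrite msizeM //; have [lti|lei] := ltnP a i.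
    have := lta _ lti; have := leb (a + b - i)%N.
    by move: (msize _) (msize _) (msize _) (msize _) A0 B0; lia.
  have ltia : (i < a)%N by rewrite ltn_neqAle lei andbT; exact: nei.
  have ltb' : (b < a + b - i)%N by lia.
  have := lea i; have := ltb _ ltb'.
  by move: (msize _) (msize _) (msize _) (msize _) A0 B0; lia.
have main : msize (mu`_a * S`_b) = (msize mu`_a + msize S`_b).-1 by rewrite msizeM.
rewrite leqNgt; apply/negP => ltsum.
have := msizeD_le (mu`_a * S`_b + r) (- r).
rewrite addrK msizeN main.
by move: (msize _) (msize _) (msize _) (msize _) A0 B0 ltsum ler; lia.
Qed.

(** * Integral equations and minimal relations *)

(** Only the lower coefficients get chosen preimages; the top one is lifted to 1, which makes the
    lift monic. *)
Lemma lift_monic (R S : nzRingType) (f : {rmorphism R -> S}) (F : {poly S}) :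
    F \is monic -> (forall j, exists a, F`_j = f a) ->
  exists2 G : {poly R}, G \is monic & map_poly f G = F.
Proof.
move=> Fmon /functional_choice[a aE]; pose N := (size F).-1.
have szF : size F = N.+1 by rewrite prednK // size_poly_gt0 monic_neq0.
exists ('X^N + \poly_(j < N) a j).
  by rewrite monicE lead_coefDl ?lead_coefXn // size_polyXn ltnS size_poly.
apply/polyP => j; rewrite coef_map /= coefD coefXn coef_poly.
have [->|neN] := eqVneq j N.
  by rewrite ltnn addr0 rmorph_nat -[RHS]/(lead_coef F) (monicP Fmon).
rewrite add0r; case: ltnP => [_|leN]; first by rewrite -aE.
by rewrite rmorph0 nth_default // szF ltn_neqAle eq_sym neN.
Qed.

(** Integral elements form a ring, and it contains the constants because [phi] fixes them. *)
Lemma integral_hom_gen (K : fieldType) n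
    (phi : {lrmorphism {mpoly K[n]} -> {mpoly K[n]}}) :
    (forall i, exists F : {poly {mpoly K[n]}},
      [/\ F \is monic, (forall j, exists a, F`_j = phi a) & F.['X_i] = 0]) ->
  integral_hom phi.
Proof.
move=> intX b; pose int := integralOver phi.
suff [G Gmon /rootP Gb] : int b.
  exists (map_poly phi G); split=> [|j|//]; first exact: monic_map.
  by exists G`_j; rewrite coef_map.
have int_gen i : int 'X_i.
  have [F [Fmon Fphi Fx]] := intX i.
  have [G Gmon GF] := lift_monic Fmon Fphi.
  by exists G => //; apply/rootP; rewrite GF.
elim/mpolyind: b => [|c m p _ _ intp]; first exact: integral0.
apply: integral_add intp; rewrite -mul_mpolyC; apply: integral_mul.
  have -> : c%:MP = phi c%:MP by rewrite -[c%:MP]mulr1 mul_mpolyC linearZ rmorph1.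
  exact: integral_id.
rewrite mpolyXE_id; elim/big_ind: _ => [|x y|i _].
- exact: integral1.
- exact: integral_mul.
elim: (m i) => [|k IH]; first exact: integral1.
by rewrite exprS; exact: integral_mul (int_gen i) IH.
Qed.

(** The remainder of pseudo-division by [Q] is a relation of smaller size, hence zero. *)
Lemma minimal_relation_dvd (R S : idomainType) (phi : {rmorphism R -> S}) (x : S)
    (Q P : {poly R}) :
    Q != 0 -> (map_poly phi Q).[x] = 0 -> (map_poly phi P).[x] = 0 ->
    (forall A : {poly R}, A != 0 -> (map_poly phi A).[x] = 0 -> (size Q <= size A)%N) ->
  exists k T, lead_coef Q ^+ k *: P = Q * T.
Proof.
move=> Q0 Qx Px minQ; have divE := Pdiv.WeakIdomain.divp_eq P Q.
exists (scalp P Q), (divp P Q).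
rewrite divE mulrC; have [->|r0] := eqVneq (modp P Q) 0; first by rewrite addr0.
have rx : (map_poly phi (modp P Q)).[x] = 0.
  have := congr1 (fun A => (map_poly phi A).[x]) divE.
  rewrite /= map_polyZ /= hornerZ Px mulr0 rmorphD rmorphM /= hornerD hornerM.
  by rewrite Qx mulr0 add0r => <-.
by have := minQ _ r0 rx; rewrite leqNgt Pdiv.CommonIdomain.ltn_modp Q0.
Qed.

(** In degree 0 a variable would have the same image as some constant, since [phi] fixes
    constants. *)
Lemma injective_hom_deg_gt0 (K : fieldType) n
    (phi : {lrmorphism {mpoly K[n]} -> {mpoly K[n]}}) :
  (0 < n)%N -> injective phi -> (0 < hom_deg phi)%N.
Proof.
move=> n0 phi_inj; rewrite lt0n; apply/negP => /eqP e0.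
pose i := Ordinal n0.
have : (msize (phi 'X_i) <= 1)%N.
  by have := msize_hom_monomial phi U_(i); rewrite e0 mul0n.
move/msize1_polyC => phiX; set c := _@_0 in phiX.
have phic : phi c%:MP = c%:MP.
  by rewrite -[c%:MP]mulr1 mul_mpolyC linearZ rmorph1.
have /(congr1 (fun p => msize p)) : 'X_i = c%:MP by apply: phi_inj; rewrite phic.
by rewrite msizeX mdeg1 msizeC; case: (c == 0).
Qed.

(** * The monic relation and the equivalence *)

Lemma monic_relation (K : fieldType) n
    (phi : {lrmorphism {mpoly K[n]} -> {mpoly K[n]}}) (x : {mpoly K[n]}) :
    let e := hom_deg phi in let m := (2 ^ n * e ^ n.-1 * (n + e ^ n))%N in
    (0 < n)%N -> integral_hom phi -> (msize x <= 2)%N ->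
  exists mu : {poly {mpoly K[n]}},
    [/\ mu \is monic, (size mu <= (e ^ n).+1)%N, forall j, (msize mu`_j <= m.+1)%N
      & (map_poly phi mu).[x] = 0].
Proof.
move=> e m n0 phi_int size_x; have phi_inj := integral_endo_inj phi_int.
have [F [Fmon Fphi Fx]] := phi_int x.
have [G Gmon GF] := lift_monic Fmon Fphi; rewrite -GF in Fx.
have [P [P0 size_P msize_P Px]] :=
  small_relation n0 (injective_hom_deg_gt0 n0 phi_inj) size_x.
pose rel (A : {poly {mpoly K[n]}}) := A != 0 /\ (map_poly phi A).[x] = 0.
have [_ [Q [Q0 Qx] <-] minQ] :
    exists2 k, (exists2 A, rel A & size A = k) &
      forall l, (exists2 A, rel A & size A = l) -> (k <= l)%N.
  by apply: nat_min_pred; exists (size P), P.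
have {}minQ A : A != 0 -> (map_poly phi A).[x] = 0 -> (size Q <= size A)%N.
  by move=> A0 Ax; apply: minQ; exists A.
have q0 : lead_coef Q != 0 by rewrite lead_coef_eq0.
have [k [S QS]] := minimal_relation_dvd Q0 Qx Fx minQ.
have [mu muE] := monic_minimal_factor (@mpoly_completely_integrally_closed K n)
  Gmon (expf_neq0 k q0) QS.
have mu_mon : mu \is monic.
  rewrite monicE; have := congr1 lead_coef muE; rewrite lead_coefM lead_coefC => E.
  by apply/eqP/(mulIf q0); rewrite mul1r -E.
(* Injectivity keeps the image of [lead_coef Q] nonzero, so it can be cancelled. *)
have mux : (map_poly phi mu).[x] = 0.
  move: Qx; rewrite muE rmorphM /= hornerM map_polyC /= hornerC => /eqP.
  by rewrite mulf_eq0 raddf_eq0 // (negPf q0) orbF => /eqP.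
have size_mu : size mu = size Q.
  by rewrite muE mulrC size_Cmul.
(* [mu] has the minimal size too and is monic, so it divides [P] without a denominator. *)
have [|l [T]] := minimal_relation_dvd (monic_neq0 mu_mon) mux Px _.
  by move=> A A0 Ax; rewrite size_mu; apply: minQ.
rewrite (monicP mu_mon) expr1n scale1r => PT.
exists mu; split=> // [|j].
  by rewrite size_mu (leq_trans (minQ _ P0 Px)).
by apply: (@msize_coef_factor _ _ mu T); rewrite -PT.
Qed.

Theorem theorem4p5 (K : fieldType) (n : nat) (hn : (0 < n)%N)
  (phi : {lrmorphism {mpoly K[n]} -> {mpoly K[n]}}) :
  let e := hom_deg phi in
  let m := (2 ^ n * e ^ n.-1 * (n + e ^ n))%N in
  integral_hom phi <->
  (exists F : 'I_n -> {poly {mpoly K[n]}},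
     forall i : 'I_n,
       [/\ F i \is monic, size (F i) = (e ^ n).+1,
           (forall j : nat, exists q : {mpoly K[n]},
               (tdeg q <= m)%N /\ (F i)`_j = phi q)
         & (F i).['X_i] = 0]).
Proof.
move=> e m; split=> [phi_int|[F FP]]; last first.
  apply: integral_hom_gen => i; have [Fmon _ Fphi Fx] := FP i.
  by exists (F i); split=> // j; have [q [_ ->]] := Fphi j; exists q.
pose monic_eq (i : 'I_n) (G : {poly {mpoly K[n]}}) :=
  [/\ G \is monic, size G = (e ^ n).+1,
     forall j : nat, exists q, (tdeg q <= m)%N /\ G`_j = phi q & G.['X_i] = 0].
suff /functional_choice[F FP] : forall i, exists G, monic_eq i G by exists F.
move=> i.
have sizeX : (msize ('X_i : {mpoly K[n]}) <= 2)%N by rewrite msizeX mdeg1.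
have [mu [mu_mon size_mu msize_mu mux]] := monic_relation hn phi_int sizeX.
pose k := ((e ^ n).+1 - size mu)%N.
exists (map_poly phi (mu * 'X^k)); split.
- by rewrite monic_map // monicMr ?monicXn.
- rewrite size_map_poly_id0 ?size_mulXn ?monic_neq0 ?subnK //.
  by rewrite (monicP _) ?rmorph1 ?oner_eq0 // monicMr ?monicXn.
- move=> j; exists (mu * 'X^k)`_j; split; last by rewrite coef_map.
  rewrite coefMXn /tdeg; case: ifP => _; first by rewrite msize0.
  by have := msize_mu (j - k)%N; case: (msize _).
by rewrite rmorphM /= hornerM mux mul0r.
Qed.
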